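(* Fix $\delta$ such that $0<\delta\le 1/256$. Consider any general causal algorithm for the two-choice system described in the context. Fix $K\in\{1,\ldots,\lfloor\frac{3}{2^{19}\delta^2}\rfloor\}$. If in the case $p=\frac12-64\delta$ the algorithm satisfies $$\frac{\sum_{k=0}^{K}\mathbb{E}[R[k]]}{\sum_{k=0}^{K}\mathbb{E}[T[k]]}>\theta^*-\delta,$$ then the algorithm fails to satisfy this inequality in the case $p=\frac12+64\delta$. (In each case, the expectations and $\theta^*$ are those corresponding to that value of $p$.)
   Context: Two-choice system: $\{S[k]\}_{k=0}^\infty$ is i.i.d. with $P[S[k]=1]=p$, $P[S[k]=0]=1-p$, where $p$ is unknown to the controller. The decision sets are $\mathcal{D}(0)=\{(1,3)\}$ and $\mathcal{D}(1)=\{(2,3),(1,1)\}$; $(2,3)$ is called high quality. General causal algorithm: let $U$ be uniform on $[0,1)$, independent of $\{S[k]\}_{k=0}^\infty$. The algorithm is specified by deterministic measurable functions $\hat\beta_k$ with values in $[0,1]$ (not depending on $p$), with $\beta[0]=\hat\beta_0(U)$ and $\beta[k]=\hat\beta_k(U,S[0],\ldots,S[k-1])$ for $k\in\{1,2,3,\ldots\}$. Here $\beta[k]$ is the conditional probability of choosing high quality on frame $k$ given that $S[k]=1$; thus, given $\beta[k]$, $(T[k],R[k])$ equals $(1,3)$ with probability $1-p$, $(2,3)$ with probability $p\beta[k]$, and $(1,1)$ with probability $p(1-\beta[k])$. Optimal ratio: for given $p$, $\theta^*$ is the supremum of $r/t$ over all pairs $(t,r)=(\mathbb{E}[T[0]],\mathbb{E}[R[0]])$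 achievable by (possibly randomized) choices $(T[0],R[0])\in\mathcal{D}(S[0])$ given $S[0]$. With $\epsilon=64\delta$, it equals $2+2\epsilon$ when $p=\frac12-\epsilon$ and $\frac{6}{3+2\epsilon}$ when $p=\frac12+\epsilon$. *)

(* Defs.v *)
From HB Require Import structures.
From mathcomp Require Import all_boot all_order all_algebra finmap.
From mathcomp Require Import all_classical all_reals all_analysis.

Set Implicit Arguments.
Unset Strict Implicit.
Unset Printing Implicit Defensive.

Import Order.TTheory GRing.Theory Num.Theory.
Import numFieldNormedType.Exports.

Local Open Scope classical_set_scope.
Local Open Scope ring_scope.

(* The state S[k] is a boolean: [true] stands for 1 and [false] for 0. *)
Definition decisions {R : realType} (s : bool) : set (R * R) :=
  if s then [set (2, 3); (1, 1)] else [set (1, 3)].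

Section independence.
Context d {T : measurableType d} {R : realType} (P : probability T R).

Definition independent_family (I : choiceType) (G : I -> set_system T) :=
  forall (J : {fset I}) (E : I -> set T), (forall i, i \in J -> G i (E i)) ->
    P (\bigcap_(i in [set` J]) E i) = (\prod_(i <- J) P (E i))%E.

Definition independent_systems (G H : set_system T) :=
  forall A B, G A -> H B -> P (A `&` B) = (P A * P B)%E.

End independence.

(* The history at frame k is a pair (U, (S[0], ..., S[k-1])); for k = 0 the
   second component is the empty tuple. *)
Record causal_algorithm (R : realType) := CausalAlgorithm {
  beta_hat : forall k : nat, R * k.-tuple bool -> R;
  measurable_beta_hat : forall k : nat,
    measurable_fun [set x : R * k.-tuple bool | 0 <= x.1 < 1] (@beta_hat k);
  beta_hat_01 : forall (k : nat) (u : R) (s : k.-tuple bool),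
    0 <= u < 1 -> 0 <= @beta_hat k (u, s) <= 1 }.

Definition beta {R : realType} (alg : causal_algorithm R) {Omega : Type}
    (U : Omega -> R) (S : nat -> Omega -> bool) (k : nat) (w : Omega) : R :=
  beta_hat alg (U w, [tuple S i w | i < k]).

(* [run_choice] says that beta[k] is the conditional probability of (2,3)
   given beta[k] and S[k] = 1, in integrated form over the events
   {S[k] = 1, beta[k] in B}. As S[k] is independent of beta[k], it follows with
   [run_decisions] that, given beta[k], the pair (T[k], R[k]) is (1,3), (2,3),
   (1,1) with probability 1 - p, p beta[k], p (1 - beta[k]). *)
Record is_run {R : realType} d (Omega : measurableType d)
    (P : probability Omega R) (p : R) (alg : causal_algorithm R)
    (U : {RV P >-> R}) (S : nat -> {RV P >-> bool})
    (T Rew : nat -> {RV P >-> R}) : Prop := IsRun {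
  run_U_range : forall w, 0 <= U w < 1;
  run_U_uniform : forall A : set R, measurable A ->
    distribution P U A = uniform_prob (@ltr01 R) A;
  run_S_law : forall k, P (S k @^-1` [set true]) = p%:E;
  run_S_independent :
    independent_family P (fun k : nat => g_sigma_algebra_preimage (S k));
  run_U_S_independent :
    independent_systems P (g_sigma_algebra_preimage U)
      <<s \bigcup_k g_sigma_algebra_preimage (S k) >>;
  run_decisions : forall k w, decisions (S k w) (T k w, Rew k w);
  run_choice : forall (k : nat) (B : set R), measurable B ->
    let C := S k @^-1` [set true] `&` beta alg U S k @^-1` B in
    P (C `&` [set w | (T k w, Rew k w) = (2, 3)]) =
    (\int[P]_(w in C) (beta alg U S k w)%:E)%E }.

Arguments is_run {R d Omega} P p alg U S T Rew.

Definition reward_ratio {R : realType} d (Omega : measurableType d)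
    (P : probability Omega R) (T Rew : nat -> {RV P >-> R}) (K : nat) : R :=
  (\sum_(0 <= k < K.+1) fine 'E_P[Rew k]%E) /
  (\sum_(0 <= k < K.+1) fine 'E_P[T k]%E).

Arguments reward_ratio {R d Omega} P T Rew K.

(* All randomized choices in [decisions S0]: the randomness of (T0, R0) beyond
   S0 is that of the arbitrary probability space. *)
Definition achievable {R : realType} (p : R) : set (R * R) :=
  [set tr | exists (d : measure_display) (Omega : measurableType d)
      (P : probability Omega R) (S0 : {RV P >-> bool}) (T0 R0 : {RV P >-> R}),
    [/\ P (S0 @^-1` [set true]) = p%:E,
        forall w, decisions (S0 w) (T0 w, R0 w),
        ('E_P[T0] = tr.1%:E)%E & ('E_P[R0] = tr.2%:E)%E]].

Definition theta_star {R : realType} (p : R) : R :=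
  sup [set tr.2 / tr.1 | tr in achievable p].

(* Main.v *)
(* Let b be the average of E[beta[k]] over the frames.  Since U and S[0], ...,
   S[k-1] are independent, E[beta[k]] is the sum, over the histories s in
   {0,1}^k, of the Bernoulli(p) weight of s times a mean of beta_hat_k(U, s)
   that does not depend on p.  Being within delta of optimality forces b < 4/127
   when p = 1/2 - e and b > 19/20 when p = 1/2 + e, with e = 64 delta.  But the
   chi-squared distance from the Bernoulli(1/2 +- e) weights to the uniform
   weights on {0,1}^k is (1 + 4 e^2)^k - 1, at most 3/29 for k <= K, so the two
   values of each E[beta[k]] differ by at most 4/5. *)
Require Import Defs.
From HB Require Import structures.
From mathcomp Require Import all_boot all_order all_algebra finmap ring lra.
From mathcomp Require Import all_classical all_reals all_analysis measurable_realfun.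

Set Implicit Arguments.
Unset Strict Implicit.
Unset Printing Implicit Defensive.

Import Order.TTheory GRing.Theory Num.Theory.
Import numFieldNormedType.Exports.

Local Open Scope classical_set_scope.
Local Open Scope ring_scope.

(** * Bernoulli path weights and their distance from uniform weights *)

Definition path_weight (R : realFieldType) (p : R) k (s : k.-tuple bool) : R :=
  \prod_(i < k) (if tnth s i then p else 1 - p).

(** Expanding the power by distributivity, each tuple selects one summand in each of the k
    factors. *)
Lemma sum_prod_tnth (R : realFieldType) k (f : bool -> R) :
  \sum_(s : k.-tuple bool) \prod_(i < k) f (tnth s i) = (f true + f false) ^+ k.
Proof.
have -> : (f true + f false) ^+ k = \prod_(i < k) \sum_(b : bool) f b.
  by rewrite big_bool prodr_const card_ord.
rewrite bigA_distr_bigA/= (reindex (@tuple_of_finfun bool k))/=; last first.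
  by exists (@finfun_of_tuple bool k) => s _; rewrite (tuple_of_finfunK, finfun_of_tupleK).
by apply: eq_bigr => g _; apply: eq_bigr => i _; rewrite tnth_mktuple.
Qed.

Lemma sum_path_weight (R : realFieldType) (p : R) k :
  \sum_(s : k.-tuple bool) path_weight p s = 1.
Proof.
rewrite [LHS](sum_prod_tnth k (fun b => if b then p else 1 - p)).
by rewrite addrC subrK expr1n.
Qed.

(** Chi-squared divergence of the path weights from the uniform weights 2^-k. Since both sum to 1,
    it equals 2^k times the sum of the squared weights, minus 1. That sum factorizes over the
    coordinates, and 2 (p^2 + (1 - p)^2) = 1 + 4 e^2. *)
Lemma chi2_path_weight (R : realFieldType) (e : R) k :
  \sum_(s : k.-tuple bool)
     (path_weight (1 / 2 + e) s - (1 / 2) ^+ k) ^+ 2 * 2 ^+ k =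
  (1 + 4 * e ^+ 2) ^+ k - 1.
Proof.
set p := 1 / 2 + e; set c := (1 / 2) ^+ k.
have c2 : c * 2 ^+ k = 1 by rewrite -exprMn mul1r mulVf ?expr1n ?pnatr_eq0.
have sq : \sum_(s : k.-tuple bool) path_weight p s ^+ 2 =
    (p ^+ 2 + (1 - p) ^+ 2) ^+ k.
  rewrite -(sum_prod_tnth k (fun b => if b then p ^+ 2 else (1 - p) ^+ 2)).
  apply: eq_bigr => s _; rewrite -prodrXl; apply: eq_bigr => i _.
  by case: (tnth s i).
transitivity (\sum_(s : k.-tuple bool)
   (path_weight p s ^+ 2 * 2 ^+ k - path_weight p s * 2 + c)).
  apply: eq_bigr => s _.
  transitivity (path_weight p s ^+ 2 * 2 ^+ k - path_weight p s * 2 * (c * 2 ^+ k)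
     + c * (c * 2 ^+ k)); first by ring.
  by rewrite c2 !mulr1.
rewrite big_split/= sumrB -!mulr_suml sq sum_path_weight -exprMn.
rewrite sumr_const card_tuple card_bool -[c *+ _]mulr_natr natrX c2.
rewrite (_ : (p ^+ 2 + (1 - p) ^+ 2) * 2 = 1 + 4 * e ^+ 2); first by ring.
by rewrite /p; field.
Qed.

(* From (1 + x)^k (1 - x)^k <= 1 and Bernoulli's inequality. *)
Lemma expr_1D_le (R : realFieldType) (x : R) k : 0 <= x <= 1 ->
  (1 + x) ^+ k * (1 - k%:R * x) <= 1.
Proof.
move=> /andP[x0 x1].
have B : 1 - k%:R * x <= (1 - x) ^+ k.
  elim: k => [|k IH]; first by rewrite mul0r subr0 expr0.
  rewrite exprSr -natr1; have kx : 0 <= k%:R * x ^+ 2 by rewrite mulr_ge0 ?sqr_ge0.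
  apply: le_trans (ler_wpM2r _ IH); last by lra.
  by nra.
apply: le_trans (ler_wpM2l _ B) _; first by rewrite exprn_ge0//; lra.
by rewrite -exprMn; apply: exprn_ile1; nra.
Qed.

(* AM-GM for the weight P of a path and c = 2^-k:
   |P - c| <= (P - c)^2 / (2 a c) + a c / 2 with a = 3/10. *)
Lemma path_weight_uniform_dist (R : realFieldType) (e : R) k
    (g : k.-tuple bool -> R) :
  (forall s, 0 <= g s <= 1) -> k%:R * (4 * e ^+ 2) <= 3 / 32 ->
  `|\sum_s path_weight (1 / 2 + e) s * g s - \sum_s (1 / 2) ^+ k * g s|
    <= 2 / 5.
Proof.
move=> g01 ke.
have chi2 : (1 + 4 * e ^+ 2) ^+ k - 1 <= 3 / 29.
  (* For k = 0 the bound [ke] says nothing about e, but the divergence is 0. For k >= 1 it gives 4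
     e^2 <= 1, as [expr_1D_le] requires, and then (1 + 4 e^2)^k <= 1 / (1 - 3/32) = 32/29. *)
  case: k g g01 ke => [|k] g g01 ke; first by rewrite expr0; lra.
  have e0 : 0 <= 4 * e ^+ 2 by rewrite mulr_ge0 ?sqr_ge0.
  have k1 : 1 <= k.+1%:R :> R by rewrite ler1n.
  have X0 : 0 <= (1 + 4 * e ^+ 2) ^+ k.+1 by rewrite exprn_ge0//; lra.
  have /(expr_1D_le k.+1) : 0 <= 4 * e ^+ 2 <= 1 by nra.
  by nra.
set c := (1 / 2) ^+ k; have c0 : 0 < c by rewrite exprn_gt0// divr_gt0.
have C0 : 0 < 2 ^+ k :> R by rewrite exprn_gt0.
have c2 : 2 ^+ k * c = 1 by rewrite -exprMn mulrC mul1r mulVf ?expr1n ?pnatr_eq0.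
have term s : `|path_weight (1 / 2 + e) s * g s - c * g s| <=
    5 / 3 * ((path_weight (1 / 2 + e) s - c) ^+ 2 * 2 ^+ k) + 3 / 20 * c.
  have /andP[g0 g1] := g01 s; set y := path_weight _ s.
  rewrite -mulrBl normrM (ger0_norm g0) -[(y - c) ^+ 2]real_normK ?num_real//.
  set z := `|y - c|; have z0 : 0 <= z by rewrite normr_ge0.
  apply: (@le_trans _ _ z); first by nra.
  (* Since 2^k = 1/c, expanding this square and dividing by 2a = 3/5 is the AM-GM bound. *)
  have : 0 <= 2 ^+ k * (z - 3 / 10 * c) ^+ 2 by rewrite mulr_ge0 ?sqr_ge0// ltW.
  have -> : 2 ^+ k * (z - 3 / 10 * c) ^+ 2 =
    z ^+ 2 * 2 ^+ k - (3 / 5) * z * (2 ^+ k * c) + 9 / 100 * c * (2 ^+ k * c) by field.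
  by rewrite c2; lra.
rewrite -sumrB; apply: le_trans (ler_norm_sum _ _ _) _.
apply: le_trans (ler_sum _ (fun s _ => term s)) _.
(* Summed over all paths, the bound is at most 5/3 * 3/29 + 3/20 < 2/5. *)
rewrite big_split/= -mulr_sumr chi2_path_weight sumr_const card_tuple card_bool.
rewrite -[_ *+ (_ ^ _)%N]mulr_natr natrX -[_ * c * _]mulrA (mulrC c) c2.
by lra.
Qed.

(** Triangle inequality through the uniform weights; the condition on k is even in e, so it serves
    both signs. *)
Lemma path_weight_dist (R : realFieldType) (e : R) k
    (g : k.-tuple bool -> R) :
  (forall s, 0 <= g s <= 1) -> k%:R * (4 * e ^+ 2) <= 3 / 32 ->
  \sum_s path_weight (1 / 2 + e) s * g s - \sum_s path_weight (1 / 2 - e) s * g s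
    <= 4 / 5.
Proof.
move=> g01 ke.
have /ler_normlP[_ +] := path_weight_uniform_dist g01 ke.
have : k%:R * (4 * (- e) ^+ 2) <= 3 / 32 by rewrite sqrrN.
move/(path_weight_uniform_dist g01)/ler_normlP => [+ _].
by lra.
Qed.

(** * From a nearly optimal ratio to the frequency of high quality *)

(* The ratio is 2 + (1 - 2 p) / (1 + p x / n), where x / n is the average
   probability of high quality over the n frames. *)
Lemma ratio_low_mean (R : realFieldType) (e n x : R) : 0 < e <= 1 / 4 -> 0 < n ->
  0 <= x ->
  3 - 2 * (1 / 2 - e) - e / 64 <
    ((3 - 2 * (1 / 2 - e)) * n + 2 * ((1 / 2 - e) * x)) / (n + (1 / 2 - e) * x) ->
  x < 4 / 127 * n.
Proof.
move=> /andP[e0 e4] n0 x0.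
have y0 : 0 <= (1 / 2 - e) * x by rewrite mulr_ge0//; lra.
rewrite ltr_pdivlMr; last by lra.
have : x * (1 / 4) <= (1 / 2 - e) * x by rewrite mulrC ler_wpM2r//; lra.
set y := (1 / 2 - e) * x in y0 * => xy h.
(* Clearing the denominator leaves e (2 - 1/64) y < e n / 64, that is 127 y < n, while p >= 1/4
   gives x <= 4 y. *)
suff : y < n / 127 by lra.
have : e * (127 * y) < e * n by move: h; lra.
by rewrite ltr_pM2l//; lra.
Qed.

(** The optimum 3 / (1 + p) is the ratio at x = n, and 2 p - 1 = 2 e measures the loss from x < n.
    Clearing denominators and cancelling e gives n - x <= 2 p (n - x) < (1 + p) (n + p x) / 64 <=
    (7/4)^2 n / 64 < n / 20. *)
Lemma ratio_high_mean (R : realFieldType) (e n x : R) : 0 < e <= 1 / 4 -> 0 < n ->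
  0 <= x <= n ->
  3 / (1 + (1 / 2 + e)) - e / 64 <
    ((3 - 2 * (1 / 2 + e)) * n + 2 * ((1 / 2 + e) * x)) / (n + (1 / 2 + e) * x) ->
  19 / 20 * n < x.
Proof.
move=> /andP[e0 e4] n0 /andP[x0 xn].
set p := 1 / 2 + e.
have p1 : 1 / 2 < p by rewrite /p; lra.
have p2 : p <= 3 / 4 by rewrite /p; lra.
have y0 : 0 <= p * x by rewrite mulr_ge0//; lra.
have yn : p * x <= 3 / 4 * n by nra.
rewrite ltr_pdivlMr; last by lra.
move=> h.
have : (3 - (1 + p) * (e / 64)) * (n + p * x) <
   (1 + p) * ((3 - 2 * p) * n + 2 * (p * x)).
  apply: le_lt_trans (_ : (1 + p) * ((3 / (1 + p) - e / 64) * (n + p * x)) < _).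
    by rewrite le_eqVlt; apply/orP; left; apply/eqP; field; lra.
  by rewrite ltr_pM2l//; lra.
have -> : (3 - (1 + p) * (e / 64)) * (n + p * x) =
   3 * (n + p * x) - e * ((1 + p) * (n + p * x)) / 64 by field.
have -> : (1 + p) * ((3 - 2 * p) * n + 2 * (p * x)) =
  3 * (n + p * x) - e * (2 * p * (n - x)) by rewrite /p; field.
move=> h2.
have : e * (2 * p * (n - x)) < e * ((1 + p) * (n + p * x) / 64) by lra.
rewrite ltr_pM2l// => h3.
have : (1 + p) * (n + p * x) <= 7 / 4 * (7 / 4 * n) by apply: ler_pM; lra.
have : n - x <= 2 * p * (n - x) by nra.
by lra.
Qed.

(** * Integration under independence and the law of the states *)

(** The restricted measure vanishes on subsets of the complement of A and agrees with [mu] inside A.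
    This moves the event from the domain of integration into the measure, so that a change of
    variables can be applied. *)
Lemma ge0_integral_mrestr d (T : measurableType d) (R : realType)
    (mu : {measure set T -> \bar R}) (A : set T) (mA : measurable A)
    (f : T -> \bar R) :
  measurable_fun [set: T] f -> (forall x, 0 <= f x)%E ->
  (\int[mrestr mu mA]_x f x = \int[mu]_(x in A) f x)%E.
Proof.
move=> mf f0; rewrite -(setUv A) ge0_integral_setU//=; last 3 first.
- exact: measurableC.
- by rewrite setUv.
- exact/disj_setPCl.
have -> : (\int[mrestr mu mA]_(x in ~` A) f x = 0)%E.
  rewrite -(integral_measure_zero (~` A) f).
  apply: eq_measure_integral => B mB BA.
  rewrite [LHS](_ : _ = mu (B `&` A))// (_ : B `&` A = set0) ?measure0//.
  exact/disjoints_subset.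
rewrite adde0; apply: eq_measure_integral => B mB BA.
by rewrite [LHS](_ : _ = mu (B `&` A))// setIidl.
Qed.

(** By independence, the image under U of P restricted to A is P A times the law of U. *)
Lemma integral_comp_independent d (T : measurableType d) (R : realType)
    (P : probability T R) (U : {RV P >-> R}) (A : set T) (f : R -> \bar R) :
  measurable A ->
  (forall B, measurable B -> P (U @^-1` B `&` A) = (P (U @^-1` B) * P A)%E) ->
  measurable_fun [set: R] f -> (forall u, 0 <= f u)%E ->
  (\int[P]_(w in A) f (U w) = P A * \int[distribution P U]_u f u)%E.
Proof.
move=> mA ind mf f0.
have mU : measurable_fun setT U by exact: measurable_funP.
have mfU : measurable_fun [set: T] (f \o U) by exact: measurableT_comp.
rewrite -(@ge0_integral_mrestr _ _ _ P A mA (f \o U))//; last by move=> x; exact: f0.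
have := @ge0_integral_pushforward _ _ _ _ _ _ mU (mrestr P mA) setT f measurableT mf
  (fun _ _ => f0 _).
rewrite preimage_setT => <-.
have PA0 : 0 <= fine (P A) by rewrite fine_ge0.
pose k : {nonneg R} := NngNum PA0.
rewrite (@eq_measure_integral _ _ _ _ (mscale k (distribution P U))) => [|B mB _].
  rewrite ge0_integral_mscale//= fineK//; exact: fin_num_measure.
rewrite /pushforward /mrestr/= /mscale/= fineK ?fin_num_measure// muleC.
exact: ind.
Qed.

Lemma prob_state_path (R : realType) d (Omega : measurableType d)
    (P : probability Omega R) (p : R) (S : nat -> {RV P >-> bool}) :
  (forall k, P (S k @^-1` [set true]) = p%:E) ->
  independent_family P (fun k : nat => g_sigma_algebra_preimage (S k)) ->
  forall (n : nat) (t : nat -> bool),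
  P (\bigcap_(i < n) (S i @^-1` [set t i])) =
    (\prod_(i < n) (if t i then p else 1 - p))%:E.
Proof.
move=> law ind n t.
have PS i b : P (S i @^-1` [set b]) = (if b then p else 1 - p)%:E.
  case: b => //; rewrite (_ : S i @^-1` [set false] = ~` (S i @^-1` [set true])).
    rewrite probability_setC ?law//.
    by rewrite -[_ @^-1` _]setTI; apply: measurable_funP.
  by apply/seteqP; split => w /=; case: (S i w).
have := ind [fset i in iota 0 n]%fset (fun i => S i @^-1` [set t i]).
rewrite (_ : [set` _] = `I_n); last first.
  by apply/seteqP; split=> i /=; rewrite !inE mem_iota add0n.
move=> ->; last first.
  by move=> i _; exists [set t i] => //; rewrite setTI.
rewrite (perm_big (iota 0 n)); last first.
  apply: uniq_perm; [exact: fset_uniq|exact: iota_uniq|].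
  by move=> i; rewrite !inE.
under eq_bigr do rewrite PS.
by rewrite prodEFin -(big_mkord xpredT (fun i => if t i then p else 1 - p)) /index_iota subn0.
Qed.

(** * Averaging the algorithm's choices over its random seed *)

(** The algorithm is constrained only for seeds in [0,1); extending by 0 gives a function that is
    measurable and [0,1]-valued on the whole line. *)
Definition choice_of (R : realType) (alg : causal_algorithm R) k
    (s : k.-tuple bool) : R -> R :=
  (fun u => beta_hat alg (u, s)) \_ [set u | 0 <= u < 1].

(** [Q] stands for the law of U. It is a parameter so that runs on different probability spaces
    share the same means, in which p does not occur. *)
Definition mean_choice (R : realType) (Q : probability R R) (alg : causal_algorithm R) k
    (s : k.-tuple bool) : R :=
  fine (\int[Q]_u (choice_of alg s u)%:E).

Lemma choice_of_01 (R : realType) (alg : causal_algorithm R) k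
    (s : k.-tuple bool) u : 0 <= choice_of alg s u <= 1.
Proof.
rewrite /choice_of patchE; case: ifPn; last by rewrite lexx ler01.
by rewrite inE => u01; exact: beta_hat_01.
Qed.

Lemma measurable_choice_of (R : realType) (alg : causal_algorithm R) k
    (s : k.-tuple bool) : measurable_fun [set: R] (choice_of alg s).
Proof.
have E01 : [set u : R | 0 <= u < 1] = [set` `[0, 1[%R].
  by apply/seteqP; split=> u /=; rewrite in_itv.
apply/(measurable_restrictT _ _).1 => //; first by rewrite E01.
apply: (measurable_comp _ _ (@measurable_beta_hat R alg k)) => //.
- rewrite (_ : [set x | _] = setT `&` fst @^-1` [set u : R | 0 <= u < 1]).
    by apply: measurable_fst => //; rewrite E01.
  by rewrite setTI.
- by move=> _ [u u01 <-].
- exact: measurable_funTS (measurable_pair2 _).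
Qed.

Lemma integral_choice_of_01 (R : realType) (Q : probability R R)
    (alg : causal_algorithm R) k (s : k.-tuple bool) :
  (0 <= \int[Q]_u (choice_of alg s u)%:E <= 1)%E.
Proof.
apply/andP; split.
  by apply: integral_ge0 => u _; have /andP[] := choice_of_01 alg s u.
rewrite -(@probability_setT _ _ _ Q) -[leRHS]mul1e.
rewrite -(integral_cst _ measurableT 1%E); apply: ge0_le_integral => //.
- by move=> u _; have /andP[] := choice_of_01 alg s u.
- by apply/measurable_EFinP; exact: measurable_choice_of.
- by move=> u _; have /andP[] := choice_of_01 alg s u.
Qed.

Lemma mean_choiceE (R : realType) (Q : probability R R)
    (alg : causal_algorithm R) k (s : k.-tuple bool) :
  ((mean_choice Q alg s)%:E = \int[Q]_u (choice_of alg s u)%:E)%E.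
Proof.
have /andP[I0 I1] := integral_choice_of_01 Q alg s.
by rewrite /mean_choice fineK// ge0_fin_numE// (le_lt_trans I1)// ltry.
Qed.

Lemma mean_choice_01 (R : realType) (Q : probability R R)
    (alg : causal_algorithm R) k (s : k.-tuple bool) :
  0 <= mean_choice Q alg s <= 1.
Proof. by rewrite -!lee_fin mean_choiceE integral_choice_of_01. Qed.

(** * Probability of high quality on a frame *)

Section run.
Context (R : realType) d (Omega : measurableType d) (P : probability Omega R).
Variables (p : R) (alg : causal_algorithm R) (U : {RV P >-> R}).
Variables (S : nat -> {RV P >-> bool}) (T Rew : nat -> {RV P >-> R}).
Hypothesis run : is_run P p alg U S T Rew.
Variable Q : probability R R.
Hypothesis QE : forall A, measurable A -> distribution P U A = Q A.

(** Independence of U is given against the sigma-algebra generated by all states, so path events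
    have to be located in it. *)
Lemma measurable_path (n : nat) (t : nat -> bool) :
  <<s \bigcup_k g_sigma_algebra_preimage (S k) >>
    (\bigcap_(i < n) (S i @^-1` [set t i])).
Proof.
pose G := \bigcup_k g_sigma_algebra_preimage (S k).
apply: (@bigcap_measurableType _ (g_sigma_algebraType G)) => // i _.
apply: sub_sigma_algebra; exists i => //; exists [set t i] => //.
by rewrite setTI.
Qed.

Lemma integral_path (n : nat) (t : nat -> bool) k (s : k.-tuple bool) :
  (\int[P]_(w in \bigcap_(i < n) (S i @^-1` [set t i]))
     (choice_of alg s (U w))%:E =
   (\prod_(i < n) (if t i then p else 1 - p) * mean_choice Q alg s)%:E)%E.
Proof.
rewrite (@integral_comp_independent _ _ _ _ _ _ (EFin \o choice_of alg s)).
- rewrite (prob_state_path (run_S_law run) (run_S_independent run)).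
  rewrite EFinM mean_choiceE; congr (_ * _)%E.
  by apply: eq_measure_integral => A mA _; exact: QE.
- apply: bigcap_measurableType => // i _.
  by rewrite -[_ @^-1` _]setTI; apply: measurable_funP.
- move=> B mB; apply: (run_U_S_independent run); last exact: measurable_path.
  by exists B => //; rewrite setTI.
- by apply/measurable_EFinP; exact: measurable_choice_of.
- by move=> u; rewrite lee_fin; have /andP[] := choice_of_01 alg s u.
Qed.

(** The probability is the integral of beta[k] over S[k] = 1. Split by the history s, beta[k]
    becomes a function of U alone, and independence factors each piece into p, the weight of s and
    the mean choice at s. *)
Lemma prob_high_quality k :
  P [set w | T k w = 2] =
    (p * \sum_(s : k.-tuple bool) path_weight p s * mean_choice Q alg s)%:E.
Proof.
have := run_choice run k measurableT.
rewrite /= preimage_setT setIT => H.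
(* The pair (2,3) is the only decision that takes time 2. *)
have -> : [set w | T k w = 2] = S k @^-1` [set true] `&` [set w | (T k w, Rew k w) = (2, 3)].
  apply/seteqP; split=> w /=.
    move=> T2; have := run_decisions run k w; rewrite T2.
    by case: (S k w) => /= [[[->]//|[e _]]|[e _]]; exfalso; clear H; lra.
  by case=> _ [].
rewrite H.
pose A (s : k.-tuple bool) := [set w | [tuple S i w | i < k] = s].
pose f (s : k.-tuple bool) := (fun w => (choice_of alg s (U w))%:E) \_ (A s).
(* Only the term of the history that actually occurred is nonzero. *)
have bE w : (beta alg U S k w)%:E = (\sum_s f s w)%E.
  rewrite (bigD1 [tuple S i w | i < k])//= [X in (_ + X)%E]big1 ?adde0.
    by rewrite /f patchE mem_set// /choice_of patchE mem_set//=; exact: run_U_range run w.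
  move=> s sw; rewrite /f patchE memNset// => ws.
  by rewrite /A /= in ws; rewrite ws eqxx in sw.
(* Index k lies beyond the end of s, so the default value [true] of [nth] encodes S[k] = 1 there. *)
have pathE s : S k @^-1` [set true] `&` A s =
    \bigcap_(i < k.+1) (S i @^-1` [set nth true s i]).
  apply/seteqP; split => w /=.
    move=> [Sk As] i /=; rewrite ltnS leq_eqVlt => /orP[/eqP ->|ik].
      by rewrite nth_default// size_tuple.
    by rewrite -As (nth_mktuple _ _ (Ordinal ik)).
  move=> H'; split; first by rewrite /= (H' k)//= nth_default// size_tuple.
  apply: eq_from_tnth => i; rewrite tnth_mktuple (tnth_nth true).
  by apply: H' => /=; rewrite ltnW// ltnS.
have mA s : measurable (A s).
  rewrite (_ : A s = \bigcap_(i < k) (S i @^-1` [set nth true s i])).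
    apply: bigcap_measurableType => // i _.
    by rewrite -[_ @^-1` _]setTI; apply: measurable_funP.
  apply/seteqP; split => w /=.
    by move=> As i /= ik; rewrite -As (nth_mktuple _ _ (Ordinal ik)).
  move=> H'; apply: eq_from_tnth => i; rewrite tnth_mktuple (tnth_nth true).
  exact: (H' i (ltn_ord i)).
have mU : measurable_fun setT U by exact: measurable_funP.
under eq_integral do rewrite bE.
rewrite ge0_integral_sum.
- rewrite mulr_sumr -sumEFin; apply: eq_bigr => s _.
  rewrite -integral_mkcondr pathE integral_path big_ord_recr/=.
  rewrite nth_default ?size_tuple//= mulrAC [in RHS]mulrC.
  congr (_ * _ * _)%:E; apply: eq_bigr => i _.
  by rewrite (tnth_nth true).
- by rewrite -[_ @^-1` _]setTI; apply: measurable_funP.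
- move=> s; apply: measurable_funTS; apply/(measurable_restrictT _ _).1 => //.
  apply/measurable_funTS/measurable_EFinP.
  exact: measurableT_comp (measurable_choice_of _ _) mU.
- move=> s w _; rewrite /f patchE; case: ifP => // _.
  by rewrite lee_fin; have /andP[] := choice_of_01 alg s (U w).
Qed.
End run.

(** * Expected time and reward per frame *)

(** Linearity for nonnegative integrands; times and rewards take this form, with at most two
    events. *)
Lemma expectation_indic_comb d (T : measurableType d) (R : realType)
    (P : probability T R) (X : T -> R) (a b c : R) (A B : set T) :
  measurable A -> measurable B -> 0 <= a -> 0 <= b -> 0 <= c ->
  (forall w, X w = a + b * \1_A w + c * \1_B w) ->
  ('E_P[X] = a%:E + b%:E * P A + c%:E * P B)%E.
Proof.
move=> mA mB a0 b0 c0 XE; rewrite unlock.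
under eq_integral do rewrite XE !EFinD !EFinM.
have m1 D : measurable D -> measurable_fun setT (fun w : T => (\1_D w)%:E : \bar R).
  by move=> mD; apply/measurable_EFinP; exact: measurable_indic.
have m2 r D : measurable D ->
    measurable_fun setT (fun w : T => (r%:E * (\1_D w)%:E)%E : \bar R).
  by move=> mD; apply: measurable_funeM; exact: m1.
have g1 D w : (0 <= (\1_D w)%:E :> \bar R)%E by rewrite lee_fin.
rewrite ge0_integralD//=.
- rewrite ge0_integralD//=.
  + rewrite integral_cst//; congr (_ + _ + _)%E.
    * by rewrite -[RHS]mule1; congr (_ * _)%E; exact: probability_setT.
    * by rewrite ge0_integralZl_EFin ?integral_indic ?setIT//; exact: m1.
    * by rewrite ge0_integralZl_EFin ?integral_indic ?setIT//; exact: m1.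
  + by move=> w _; rewrite mule_ge0.
  + exact: m2.
- by move=> w _; rewrite adde_ge0// mule_ge0.
- by apply: emeasurable_funD => //; exact: m2.
- by move=> w _; rewrite mule_ge0.
- exact: m2.
Qed.

Lemma decisionsP (R : realType) (s : bool) (t r : R) : decisions s (t, r) ->
  [\/ [/\ s = true, t = 2 & r = 3], [/\ s = true, t = 1 & r = 1]
    | [/\ s = false, t = 1 & r = 3]].
Proof.
case: s => /=; last by case=> -> ->; constructor 3.
by case=> -[-> ->]; [constructor 1|constructor 2].
Qed.

Section run_expectations.
Context (R : realType) d (Omega : measurableType d) (P : probability Omega R).
Variables (p : R) (alg : causal_algorithm R) (U : {RV P >-> R}).
Variables (S : nat -> {RV P >-> bool}) (T Rew : nat -> {RV P >-> R}).
Hypothesis run : is_run P p alg U S T Rew.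
Variable Q : probability R R.
Hypothesis QE : forall A, measurable A -> distribution P U A = Q A.

Let b k := \sum_(s : k.-tuple bool) path_weight p s * mean_choice Q alg s.

Lemma measurable_state_eq k s : measurable (S k @^-1` [set s]).
Proof. by rewrite -[_ @^-1` _]setTI; apply: measurable_funP. Qed.

Lemma measurable_high_quality k : measurable [set w | T k w = 2].
Proof.
rewrite (_ : [set w | _] = setT `&` T k @^-1` [set 2]) ?setTI//.
Qed.

Lemma run_decisionsP k w :
  [\/ [/\ S k w = true, T k w = 2 & Rew k w = 3],
    [/\ S k w = true, T k w = 1 & Rew k w = 1]
    | [/\ S k w = false, T k w = 1 & Rew k w = 3]].
Proof. exact: decisionsP (run_decisions run k w). Qed.

Lemma expectation_time k : ('E_P[T k] = (1 + p * b k)%:E)%E.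
Proof.
(* T[k] is 1 plus the indicator of high quality; the second event is padding. *)
rewrite (@expectation_indic_comb _ _ _ _ _ 1 1 0 [set w | T k w = 2] set0)//.
- by rewrite (prob_high_quality run QE) mul0e adde0 mul1e EFinD.
- exact: measurable_high_quality.
- move=> w; rewrite mul0r addr0 mul1r indicE.
  have [T2|/eqP T2] := eqVneq (T k w) 2; first by rewrite T2 mem_set//= -natrD.
  rewrite memNset//= addr0.
  by case: (run_decisionsP k w) => -[].
Qed.

(** The reward is 1, plus 2 if S[k] = 0, plus 2 if high quality is chosen. *)
Lemma expectation_reward k : ('E_P[Rew k] = (3 - 2 * p + 2 * (p * b k))%:E)%E.
Proof.
rewrite (@expectation_indic_comb _ _ _ _ _ 1 2 2
  (S k @^-1` [set false]) [set w | T k w = 2])//.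
- have -> : S k @^-1` [set false] = ~` (S k @^-1` [set true]).
    by apply/seteqP; split => w /=; case: (S k w).
  rewrite probability_setC; last exact: measurable_state_eq.
  rewrite (run_S_law run) (prob_high_quality run QE) -EFinB -!EFinM -!EFinD.
  by congr (_%:E); rewrite -/(b k); ring.
- exact: measurable_state_eq.
- exact: measurable_high_quality.
- move=> w; rewrite !indicE.
  have n12 : (1 : R) <> 2 by lra.
  case: (run_decisionsP k w) => -[Sw Tw ->].
  - rewrite memNset/= ?mem_set//= ?Sw//; ring.
  - rewrite !memNset//= ?Sw ?Tw//; ring.
  - rewrite mem_set/= ?memNset//= ?Sw ?Tw//; ring.
Qed.
End run_expectations.

(** * Lower bounds for the optimal ratio *)

(** [sup] dominates the ratios once they are bounded above: times are at least 1 and rewards at most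
    3, so 3 is a bound. *)
Lemma theta_star_ge (R : realType) (p t r : R) :
  achievable p (t, r) -> r / t <= theta_star p.
Proof.
move=> ach; apply: ub_le_sup; last by exists (t, r).
exists 3 => _ [[t' r'] [d [W [P [S0 [T0 [R0 [_ dec /= ET ER]]]]]]] <-] /=.
have t1 : 1 <= t'.
  rewrite -lee_fin -ET -(expectation_cst P 1); apply: expectation_le => //.
  - by move=> w; case: (decisionsP (dec w)) => -[_ -> _].
  - by apply: aeW => w; case: (decisionsP (dec w)) => -[_ -> _] /=; lra.
have r3 : r' <= 3.
  rewrite -lee_fin -ER -(expectation_cst P 3); apply: expectation_le => //.
  - by move=> w; case: (decisionsP (dec w)) => -[_ _ ->].
  - by apply: aeW => w; case: (decisionsP (dec w)) => -[_ _ ->] /=; lra.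
rewrite ler_pdivrMr; lra.
Qed.

Section witness.
Context (R : realType) d (Omega : measurableType d) (P : probability Omega R).
Variables (p : R) (S0 : {RV P >-> bool}).
Hypothesis law : P (S0 @^-1` [set true]) = p%:E.

Let measurable_branch (a b : R) :
  measurable_fun [set: Omega] (fun w => if S0 w then a else b).
Proof. by apply: measurable_fun_ifT => //; exact: measurable_funP. Qed.

Let branch (a b : R) : {RV P >-> R} :=
  HB.pack (fun w => if S0 w then a else b)
    (isMeasurableFun.Build _ _ _ _ _ (measurable_branch a b)).

Let mS0 s : measurable (S0 @^-1` [set s]).
Proof. by rewrite -[_ @^-1` _]setTI; apply: measurable_funP. Qed.

Let expectation_branch (a b : R) : 0 <= a -> 0 <= b ->
  'E_P[branch a b]%E = (p * a + (1 - p) * b)%:E.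
Proof.
move=> a0 b0.
rewrite (@expectation_indic_comb _ _ _ _ _ 0 a b (S0 @^-1` [set true])
  (S0 @^-1` [set false]))//.
  have -> : S0 @^-1` [set false] = ~` (S0 @^-1` [set true]).
    by apply/seteqP; split => w /=; case: (S0 w).
  by rewrite probability_setC// law add0e -EFinB -!EFinM -EFinD mulrC (mulrC b).
move=> w; rewrite !indicE.
have inS s : (w \in S0 @^-1` [set s]) = (S0 w == s) by apply/idP/eqP; rewrite inE.
by rewrite !inS /=; case: (S0 w); rewrite /= !(mulr1, mulr0, addr0, add0r).
Qed.

(** The policy that never chooses high quality; at p = 1/2 - e its ratio is 2 + 2 e. *)
Lemma achievable_low : achievable p (1, 3 - 2 * p).
Proof.
exists d, Omega, P, S0, (branch 1 1), (branch 1 3); split=> //.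
- by move=> w /=; case: (S0 w) => //=; right.
- by rewrite expectation_branch//=; congr (_%:E); ring.
- by rewrite expectation_branch//=; congr (_%:E); ring.
Qed.

(** The policy that always chooses high quality; at p = 1/2 + e its ratio is 6 / (3 + 2 e). *)
Lemma achievable_high : achievable p (1 + p, 3).
Proof.
exists d, Omega, P, S0, (branch 2 1), (branch 3 3); split=> //.
- by move=> w /=; case: (S0 w) => //=; left.
- by rewrite expectation_branch//=; congr (_%:E); ring.
- by rewrite expectation_branch//=; congr (_%:E); ring.
Qed.
End witness.

(** * Comparison of the two cases *)

(** This is E[beta[k]] as an explicit function of p, so that one algorithm and one [Q] can be
    evaluated at both values of p. *)
Definition mean_beta (R : realType) (Q : probability R R) (alg : causal_algorithm R)
    (p : R) k : R :=
  \sum_(s : k.-tuple bool) path_weight p s * mean_choice Q alg s.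

Lemma mean_beta_01 (R : realType) (Q : probability R R)
    (alg : causal_algorithm R) (p : R) k :
  0 <= p <= 1 -> 0 <= mean_beta Q alg p k <= 1.
Proof.
move=> /andP[p0 p1].
have w0 (s : k.-tuple bool) : 0 <= path_weight p s.
  by apply: prodr_ge0 => i _; case: (tnth s i); lra.
apply/andP; split.
  by apply: sumr_ge0 => s _; rewrite mulr_ge0//; have /andP[] := mean_choice_01 Q alg s.
rewrite -(sum_path_weight p k); apply: ler_sum => s _.
by rewrite ler_piMr//; have /andP[] := mean_choice_01 Q alg s.
Qed.

Lemma reward_ratioE (R : realType) d (Omega : measurableType d)
    (P : probability Omega R) (p : R) (alg : causal_algorithm R)
    (U : {RV P >-> R}) (S : nat -> {RV P >-> bool}) (T Rew : nat -> {RV P >-> R})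
    (Q : probability R R) (K : nat) :
  is_run P p alg U S T Rew ->
  (forall A, measurable A -> distribution P U A = Q A) ->
  let x := \sum_(0 <= k < K.+1) mean_beta Q alg p k in
  reward_ratio P T Rew K =
    ((3 - 2 * p) * K.+1%:R + 2 * (p * x)) / (K.+1%:R + p * x).
Proof.
move=> run QE x; rewrite /reward_ratio.
under eq_bigr do rewrite (expectation_reward run QE)/=.
under [X in _ / X]eq_bigr do rewrite (expectation_time run QE)/=.
rewrite !big_split/= -!mulr_sumr !sumr_const_nat subn0; congr (_ / _).
by rewrite -[- (2 * p) *+ _]mulr_natr /x /mean_beta; ring.
Qed.

Theorem theorem5 (R : realType) (delta : R)
    (hdelta : 0 < delta <= 1 / 256)
    (alg : causal_algorithm R)
    (K : nat) (hK1 : (1 <= K)%N)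
    (hK : K%:Z <= Num.floor (3 / (2 ^+ 19 * delta ^+ 2)))
    (d1 : measure_display) (Omega1 : measurableType d1)
    (P1 : probability Omega1 R)
    (U1 : {RV P1 >-> R}) (S1 : nat -> {RV P1 >-> bool})
    (T1 R1 : nat -> {RV P1 >-> R})
    (hrun1 : is_run P1 (1 / 2 - 64 * delta) alg U1 S1 T1 R1)
    (d2 : measure_display) (Omega2 : measurableType d2)
    (P2 : probability Omega2 R)
    (U2 : {RV P2 >-> R}) (S2 : nat -> {RV P2 >-> bool})
    (T2 R2 : nat -> {RV P2 >-> R})
    (hrun2 : is_run P2 (1 / 2 + 64 * delta) alg U2 S2 T2 R2) :
  reward_ratio P1 T1 R1 K > theta_star (1 / 2 - 64 * delta) - delta ->
  ~ (reward_ratio P2 T2 R2 K > theta_star (1 / 2 + 64 * delta) - delta).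
Proof.
move: hdelta => /andP[d0 d256] h1 h2.
pose e := 64 * delta; pose Q : probability R R := distribution P1 U1.
have e01 : 0 < e <= 1 / 4 by rewrite /e; lra.
(* Here 4 * 64^2 = 2^14 = 2^19 / 32, so the assumed range of K is exactly this bound. *)
have Ke : K%:R * (4 * e ^+ 2) <= 3 / 32.
  move: hK; rewrite floor_ge_int ler_pdivlMr; last by rewrite mulr_gt0 ?exprn_gt0.
  rewrite -[K%:Z%:~R]/(K%:R) /e => KK.
  have -> : K%:R * (4 * (64 * delta) ^+ 2) = K%:R * (2 ^+ 19 * delta ^+ 2) / 32 by field.
  by rewrite ler_pM2r.
(* Both seeds are uniform, so the law of [U1] also serves for the second run. *)
have Q2 A : measurable A -> distribution P2 U2 A = Q A.
  by move=> mA; rewrite (run_U_uniform hrun2 mA) -(run_U_uniform hrun1 mA).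
pose x p := \sum_(0 <= k < K.+1) mean_beta Q alg p k.
have x01 p : 0 <= p <= 1 -> 0 <= x p <= K.+1%:R.
  move=> p01; apply/andP; split.
    by apply: sumr_ge0 => k _; have /andP[] := mean_beta_01 Q alg k p01.
  rewrite -[leRHS]/(1 *+ K.+1) -[in leRHS](subn0 K.+1) -sumr_const_nat.
  by apply: ler_sum => k _; have /andP[] := mean_beta_01 Q alg k p01.
have n0 : 0 < K.+1%:R :> R by rewrite ltr0n.
have p1 : 0 <= 1 / 2 - e <= 1 by rewrite /e; lra.
have p2 : 0 <= 1 / 2 + e <= 1 by rewrite /e; lra.
have low : x (1 / 2 - e) < 4 / 127 * K.+1%:R.
  apply: (@ratio_low_mean _ e) => //; first by have /andP[] := x01 _ p1.
  have <- := @reward_ratioE _ _ _ _ _ _ _ _ _ _ Q K hrun1 (fun _ _ => erefl).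
  (* The state of frame 0 supplies the probability space for the comparison policy, and e / 64 is
     [delta]. *)
  have := theta_star_ge (achievable_low (run_S_law hrun1 0)).
  by move: h1; rewrite /e; lra.
have high : 19 / 20 * K.+1%:R < x (1 / 2 + e).
  apply: (@ratio_high_mean _ e) => //; first exact: x01.
  have <- := @reward_ratioE _ _ _ _ _ _ _ _ _ _ Q K hrun2 Q2.
  have := theta_star_ge (achievable_high (run_S_law hrun2 0)).
  by move: h2; rewrite /e; lra.
have dist : x (1 / 2 + e) - x (1 / 2 - e) <= 4 / 5 * K.+1%:R.
  rewrite /x -sumrB mulr_natr -[in leRHS](subn0 K.+1) -sumr_const_nat.
  (* The range k <= K is kept so that [Ke] bounds the divergence on every frame. *)
  rewrite !big_nat; apply: ler_sum => k /andP[_ kK].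
  apply: path_weight_dist => [s|]; first exact: mean_choice_01.
  apply: le_trans Ke; apply: ler_wpM2r; first by rewrite mulr_ge0 ?sqr_ge0.
  by rewrite ler_nat -ltnS.
(* The contradiction is 19/20 - 4/127 > 4/5. *)
move: n0 low high dist; move: (x _) (x _) (_.+1%:R) => x1 x2 n.
by clear; lra.
Qed.
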